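(* Let $X$ be a separated topological space and $A$ a closed subset of $X$. Suppose that at least one of the following two conditions holds: (C1) $X$ is completely normal; (C2) $X$ is normal and $A$ (with the topology induced from $X$) is perfectly normal. Let $f,g:A\to[0,1]$ be two (single-valued) functions such that $f$ is lower semicontinuous, $g$ is upper semicontinuous, and $f(x)\le g(x)$ for every $x\in A$. Then there exist functions $\widetilde{f},\widetilde{g}:X\to[0,1]$ extending $f$ and $g$ respectively (i.e. $\widetilde{f}|_A=f$ and $\widetilde{g}|_A=g$) such that $\widetilde{f}$ is lower semicontinuous on $X$, $\widetilde{g}$ is upper semicontinuous on $X$, and $\widetilde{f}(x)\le\widetilde{g}(x)$ for every $x\in X$.
   Context: Separated means Hausdorff. Subsets are endowed with the induced topology. Lower and upper semicontinuity are the usual notions for real-valued functions. A separated space is completely normal if every subspace of it is normal (equivalently, any subsets $P,Q$ with $\overline{P}\cap Q=P\cap\overline{Q}=\emptyset$ can be separated by disjoint open sets). A separated space is perfectly normal if each of its closed subsets is a $G_\delta$-set, i.e. a countable intersection of open sets. *)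

(* Defs.v *)
From mathcomp Require Import all_boot all_order all_algebra.
From mathcomp Require Import all_classical all_reals all_analysis.
From mathcomp Require Import borel_hierarchy.

Set Implicit Arguments.
Unset Strict Implicit.
Unset Printing Implicit Defensive.

Local Open Scope classical_set_scope.
Local Open Scope ring_scope.

(* A set [S : set T], seen as a type, carries the topology induced from [T]. *)
Definition completely_normal_space (T : topologicalType) : Prop :=
  hausdorff_space T /\ forall S : set T, @normal_space S.

(* Normality is deliberately not part of this definition. *)
Definition perfectly_normal_space (T : topologicalType) : Prop :=
  hausdorff_space T /\ forall C : set T, closed C -> Gdelta C.

(* Mirrors the library's [lower_semicontinuous], hence the extended-real
   codomain. *)
Definition upper_semicontinuous (X : topologicalType) (R : numFieldType)
    (f : X -> \bar R) : Prop :=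
  forall x a, (f x < a%:E)%E ->
    exists2 V, nbhs x V & forall y, V y -> (f y < a%:E)%E.

(* Main.v *)
Require Import Defs.
From mathcomp Require Import all_boot all_order all_algebra.
From mathcomp Require Import all_classical all_reals all_analysis.
From mathcomp Require Import lra.

(* For rational q put U q = {f > q} and V q = {g < q}. These are open in A, and
   disjoint because f <= g, so neither meets the closure of the other, and they
   can be separated by open sets of X: under (C1) by normality of an open
   subspace, under (C2) because open subsets of A are countable unions of closed
   sets of X. Choosing such separations compatibly gives open sets U' q and V' q
   of X with traces U q and V q on A and with U' q disjoint from V' s for s <= q.
   Then f' x = sup {q | x in U' q} and g' x = inf {q | x in V' q} extend f and
   g, and f' x > g' x would put x in some U' q and V' s with s < q. *)

Set Implicit Arguments.
Unset Strict Implicit.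
Unset Printing Implicit Defensive.

Import Order.TTheory GRing.Theory Num.Theory.

Local Open Scope classical_set_scope.
Local Open Scope ring_scope.

(** * Separation of two sets by open sets *)

Definition open_separated (X : topologicalType) (U V : set X) : Prop :=
  exists P Q : set X,
    [/\ open P, open Q, U `<=` P, V `<=` Q & P `&` Q = set0].

Lemma normal_shrink (X : topologicalType) (C O : set X) :
  normal_space X -> closed C -> open O -> C `<=` O ->
  exists W : set X, [/\ open W, C `<=` W & closure W `<=` O].
Proof.
move=> nX cC oO CO; have [|B CB BO] := nX C cC O.
  by move=> x Cx; apply: open_nbhs_nbhs; split=> //; exact: CO.
exists B°; split; first exact: open_interior.
- by move=> x Cx; exact: CB.
- by apply: subset_trans BO; apply: closure_subset; exact: interior_subset.
Qed.

(* Normality is applied to the open subspace where the two closures do not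
   meet: both sets lie in it, and open sets of it are open in the whole space. *)
Lemma completely_normal_separated (X : topologicalType) (U V : set X) :
  completely_normal_space X ->
  closure U `&` V = set0 -> U `&` closure V = set0 -> open_separated U V.
Proof.
move=> [_ nX] cUV UcV.
pose S : set X := ~` (closure U `&` closure V).
have oS : open S by apply: closed_openC; apply: closedI; exact: closed_closure.
have cval (D : set X) : closed D -> closed ((val : S -> X) @^-1` D).
  by move=> cD; rewrite -openC; exists (~` D) => //; exact: closed_openC.
have oval (D : set X) : open D -> open ((val : S -> X) @^-1` D) by exists D.
have [||W [[G1 oG1 <-] UW Wc]] := normal_shrink
    (O := (val : S -> X) @^-1` (~` closure V)) (nX S) (cval _ (@closed_closure _ U)).
- by apply: oval; apply: closed_openC; exact: closed_closure.
- by move=> [x Sx] /= Ux Vx; move: (set_mem Sx); apply.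
(* The closure is taken in [S], so [G2] is known to avoid [G1] only there; hence both sets are cut
   down to [S]. *)
have [G2 oG2 G2W] : open (~` closure ((val : S -> X) @^-1` G1)).
  by apply: closed_openC; exact: closed_closure.
exists (G1 `&` S), (G2 `&` S); split; [exact: openI|exact: openI| | |].
- move=> x Ux; have Sx : S x.
    by move=> [_ Vx]; have : (U `&` closure V) x by []; rewrite UcV.
  split=> //; apply: (UW (exist _ x (mem_set Sx))) => /=; exact: subset_closure.
- move=> x Vx; have Sx : S x.
    by move=> [Ux _]; have : (closure U `&` V) x by []; rewrite cUV.
  split=> //; pose y : S := exist _ x (mem_set Sx).
  have : (val @^-1` G2) y.
    by rewrite G2W => /Wc /=; apply; exact: subset_closure.
  by [].
- rewrite -subset0 => x [[G1x Sx] [G2x _]].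
  pose y : S := exist _ x (mem_set Sx).
  have : (val @^-1` G2) y by [].
  by rewrite G2W; apply; exact: subset_closure.
Qed.

(** Each closed piece gets an open neighbourhood whose closure misses the closure of the other
    union. Removing finitely many such closures from each neighbourhood keeps it open, loses no
    point of its piece, and makes the two unions disjoint. *)
Lemma normal_bigcup_separated (X : topologicalType) (C D : nat -> set X) :
  normal_space X -> (forall n, closed (C n)) -> (forall n, closed (D n)) ->
  closure (\bigcup_n C n) `&` \bigcup_n D n = set0 ->
  \bigcup_n C n `&` closure (\bigcup_n D n) = set0 ->
  open_separated (\bigcup_n C n) (\bigcup_n D n).
Proof.
move=> nX cC cD; set U := \bigcup_n C n; set V := \bigcup_n D n => cUV UcV.
have shrink (F : nat -> set X) (E : set X) : (forall n, closed (F n)) ->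
    \bigcup_n F n `&` closure E = set0 ->
    exists W : nat -> set X, forall n,
      [/\ open (W n), F n `<=` W n & closure (W n) `&` closure E = set0].
  move=> cF FE; suff /choice[W HW] : forall n, exists W, [/\ open W, F n `<=` W
      & closure W `&` closure E = set0] by exists W.
  move=> n; have [||W [oW FW WE]] :=
    normal_shrink (O := ~` closure E) nX (cF n).
  - by apply: closed_openC; exact: closed_closure.
  - move=> x Fx Ex; suff : set0 x by [].
    by rewrite -FE; split=> //; exists n.
  - by exists W; split=> //; exact/disjoints_subset.
have [G HG] := shrink _ _ cC UcV.
have [W HW] : exists W : nat -> set X, forall n,
    [/\ open (W n), D n `<=` W n & closure (W n) `&` closure U = set0].
  by apply: shrink => //; rewrite setIC.
(* The removed indices include [n] itself, so that of two indices, equal or not, the larger one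
   always excludes the other. *)
pose cut (E F : nat -> set X) :=
  \bigcup_n (E n `&` ~` \bigcup_(k in `I_n.+1) closure (F k)).
have open_cut E F : (forall n, open (E n)) -> open (cut E F).
  move=> oE; apply: bigcup_open => n _; apply: openI => //.
  apply: closed_openC; apply: closed_bigcup => [|k _]; first exact: finite_II.
  exact: closed_closure.
exists (cut G W), (cut W G); split.
- by apply: open_cut => n; case: (HG n).
- by apply: open_cut => n; case: (HW n).
- move=> x [n _ Cx]; exists n => //; split; first by case: (HG n) => _ + _; exact.
  move=> [k _ Wx]; have [_ _ WU] := HW k; suff : set0 x by [].
  by rewrite -WU; split=> //; apply: subset_closure; exists n.
- move=> x [n _ Dx]; exists n => //; split; first by case: (HW n) => _ + _; exact.
  move=> [k _ Gx]; have [_ _ GV] := HG k; suff : set0 x by [].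
  by rewrite -GV; split=> //; apply: subset_closure; exists n.
- rewrite -subset0 => x [[n _ [Gn nW]] [m _ [Wm nG]]].
  have [mn|/ltnW nm] := leqP m n.
  + by apply: nW; exists m => //; exact: subset_closure.
  + by apply: nG; exists n => //; exact: subset_closure.
Qed.

(** * From level sets on [A] to open sets of [X] *)

Section closed_subspace.
Context (X : topologicalType) (A : set X).

Lemma closure_val_disjoint (U V : set A) :
  open V -> U `&` V = set0 -> closure (val @` U) `&` val @` V = set0.
Proof.
move=> [G oG <-] UV; rewrite -subset0 => _ [/[swap] [[x Gx <-]] cx].
have [] := cx G; first by apply: open_nbhs_nbhs.
move=> _ [[y Uy <-] Gy]; suff : set0 y by [].
by rewrite -UV.
Qed.

Lemma closed_val (C : set A) : closed A -> closed C -> closed (val @` C).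
Proof.
move=> cA; rewrite -openC => -[G oG GC].
suff -> : val @` C = A `&` ~` G by apply: closedI => //; exact: open_closedC.
rewrite eqEsubset; split=> [_ [x Cx <-]|x [Ax nGx]].
- split; first exact: set_valP.
  by move=> Gx; have : (val @^-1` G) x by []; rewrite GC; apply.
- exists (exist _ x (mem_set Ax)) => //; apply: contrapT.
  by move=> nCx; apply: nGx; move: nCx; rewrite -[~ _]/((~` C) _) -GC.
Qed.

Lemma perfectly_normal_open_bigcup (U : set A) :
  perfectly_normal_space A -> open U ->
  exists2 C : nat -> set A, forall n, closed (C n) & U = \bigcup_n C n.
Proof.
move=> [_ pA] oU; have [|F oF UF] := pA (~` U); first exact: open_closedC.
exists (fun n => ~` F n) => [n|]; first exact: open_closedC.
by rewrite -setC_bigcap -UF setCK.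
Qed.

Lemma open_separated_val (U V : set A) : closed A ->
  completely_normal_space X \/
    (normal_space X /\ perfectly_normal_space A) ->
  open U -> open V -> U `&` V = set0 ->
  open_separated (val @` U) (val @` V).
Proof.
move=> cA hC oU oV UV.
have cUV := closure_val_disjoint oV UV.
have UcV : val @` U `&` closure (val @` V) = set0.
  by rewrite setIC; apply: closure_val_disjoint => //; rewrite setIC.
case: hC => [cnX|[nX pA]]; first exact: completely_normal_separated.
have [C cC UC] := perfectly_normal_open_bigcup pA oU.
have [D cD VD] := perfectly_normal_open_bigcup pA oV.
move: cUV UcV; rewrite UC VD !image_bigcup.
by apply: normal_bigcup_separated => // n; exact: closed_val.
Qed.

(** A separating set may meet [A] outside [U]. Intersecting it with [G] on [A], and leaving it alone
    off [A], corrects the trace; closedness of [A] keeps the result open. *)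
Lemma open_trace (U : set A) (P : set X) : closed A -> open U -> open P ->
  val @` U `<=` P ->
  exists P' : set X, [/\ open P', P' `<=` P & val @^-1` P' = U].
Proof.
move=> cA [G oG <-] oP GP; exists (P `&` (G `|` ~` A)); split.
- by apply: openI => //; apply: openU => //; exact: closed_openC.
- exact: subIsetl.
- rewrite eqEsubset; split=> x /=; last first.
    by move=> Gx; split; [apply: GP; exists x|left].
  by move=> [_ [//|nAx]]; case: nAx; exact: set_valP.
Qed.

End closed_subspace.

(* Separating [U q] from [V q] for each [q] independently does not make [U' q]
   disjoint from [V' s] for [s < q]. Intersecting [U' q] with all [U' i], [i < q],
   would, but need not be open, so only the finitely many [i] enumerated before
   [q] are used, and dually for [V']. *)
Lemma open_separated_family (X : topologicalType) (U V : rat -> set X) :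
  (forall s q, s <= q -> U q `<=` U s) ->
  (forall s q, s <= q -> V s `<=` V q) ->
  (forall q, open_separated (U q) (V q)) ->
  exists U' V' : rat -> set X,
    [/\ forall q, open (U' q), forall q, open (V' q),
        forall q, U q `<=` U' q, forall q, V q `<=` V' q &
        forall s q, s <= q -> U' q `&` V' s = set0].
Proof.
move=> Ule Vle /choice[P /choice[Q PQ]].
pose cut (r : rel rat) (F : rat -> set X) q := ~` \bigcup_(i in
  [set i : rat | r i q /\ (pickle i <= pickle q)%N]) ~` F i.
have open_cut r F q : (forall i, open (F i)) -> open (cut r F q).
  move=> oF; apply: closed_openC; apply: closed_bigcup => [|i _].
  - apply: (@sub_finite_set _ _ (@pickle rat @^-1` `I_(pickle q).+1)).
      by move=> i [].
    apply: finite_preimage; last exact: finite_II.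
    by move=> i j _ _; exact: (pcan_inj (@pickleK rat)).
  - exact: open_closedC.
have sub_cut (r : rel rat) F (G : rat -> set X) q :
    (forall i, r i q -> G q `<=` F i) -> G q `<=` cut r F q.
  by move=> GF x Gx [i [iq _]]; apply; exact: GF Gx.
have cut_sub (r : rel rat) F i q :
    r i q -> (pickle i <= pickle q)%N -> cut r F q `<=` F i.
  by move=> iq piq x cx; apply: contrapT => nFx; apply: cx; exists i.
pose le : rel rat := fun i q => i <= q.
pose ge : rel rat := fun i q => q <= i.
exists (cut le P), (cut ge Q); split.
- by move=> q; apply: open_cut => i; case: (PQ i).
- by move=> q; apply: open_cut => i; case: (PQ i).
- move=> q; apply: sub_cut => i iq x /(Ule _ _ iq).
  by case: (PQ i) => _ _ + _ _; exact.
- move=> q; apply: sub_cut => i iq x /(Vle _ _ iq).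
  by case: (PQ i) => _ _ _ + _; exact.
- move=> s q sq; rewrite -subset0 => x [Px Qx].
  (* Whichever of [s] and [q] is enumerated first occurs in both cuts, so disjointness at that
     single index suffices. *)
  have [psq|/ltnW pqs] := leqP (pickle s) (pickle q).
  + have [_ _ _ _ <-] := PQ s; split; first exact: (cut_sub le P s q).
    exact: (cut_sub ge Q s s (lexx s)).
  + have [_ _ _ _ <-] := PQ q; split; last exact: (cut_sub ge Q q s).
    exact: (cut_sub le P q q (lexx q)).
Qed.

(** * Functions built from families of open sets *)

Section level_sup.
Context (R : realType) (X : topologicalType) (P : rat -> set X).

(* The element [0] keeps the supremum nonnegative and away from the junk value
   of [sup] on the empty set. *)
Definition level_set (x : X) : set R :=
  [set t | t = 0 \/ exists q : rat, [/\ q <= 1, P q x & t = ratr q]].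

Definition level_sup (x : X) : R := sup (level_set x).

Lemma level_set_ubound1 x : ubound (level_set x) 1.
Proof. by move=> _ [->|[q [q1 _ ->]]] //; rewrite -(rmorph1 (@ratr R)) ler_rat. Qed.

Lemma level_set_neq0 x : level_set x !=set0.
Proof. by exists 0; left. Qed.

Lemma level_sup_ub x t : level_set x t -> t <= level_sup x.
Proof. by apply: ub_le_sup; exists 1; exact: level_set_ubound1. Qed.

Lemma level_sup01 x : 0 <= level_sup x <= 1.
Proof.
apply/andP; split; first by apply: level_sup_ub; left.
by apply: ge_sup; [exact: level_set_neq0|exact: level_set_ubound1].
Qed.

Lemma level_sup_lsc : (forall q, open (P q)) ->
  lower_semicontinuous (EFin \o level_sup).
Proof.
move=> oP x a; rewrite /= lte_fin => /(sup_gt (level_set_neq0 x))[t].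
case=> [->|[q [q1 Pq ->]]] at_.
(* Here [a < 0], and [level_sup] is nonnegative everywhere. *)
- exists setT => [|y _]; first exact: filterT.
  by rewrite lte_fin (lt_le_trans at_)//; case/andP: (level_sup01 y).
- exists (P q); first by apply: open_nbhs_nbhs.
  move=> y Py; rewrite lte_fin (lt_le_trans at_)//.
  by apply: level_sup_ub; right; exists q.
Qed.

Lemma level_supE x t : 0 <= t <= 1 ->
  (forall q : rat, P q x <-> ratr q < t) -> level_sup x = t.
Proof.
move=> /andP[t0 t1] Pt; apply/eqP; rewrite eq_le; apply/andP; split.
  apply: ge_sup; first exact: level_set_neq0.
  by move=> _ [->//|[q [_ /Pt /ltW qt ->]]].
rewrite leNgt; apply/negP => /rat_in_itvoo[q].
rewrite in_itv /= => /andP[ltq qt]; move: ltq; apply/negP; rewrite -leNgt.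
apply: level_sup_ub; right; exists q; split=> //; last exact/Pt.
by rewrite -(ler_rat R) rmorph1 (le_trans (ltW qt)).
Qed.

End level_sup.

Lemma lower_semicontinuous_open (X : topologicalType) (R : realType)
    (f : X -> R) a :
  lower_semicontinuous (EFin \o f) -> open [set x | a < f x].
Proof. by move/lower_semicontinuousP => /(_ a). Qed.

Lemma lower_semicontinuous_subl (X : topologicalType) (R : realType)
    (c : R) (f : X -> R) :
  lower_semicontinuous (EFin \o (fun x => c - f x)) <->
  upper_semicontinuous (EFin \o f).
Proof.
split=> H x a /=.
- rewrite lte_fin => fa; have [|V Vx HV] := H x (c - a).
    by rewrite /= lte_fin ltrD2l ltrN2.
  exists V => // y /HV; rewrite /= !lte_fin; lra.
- rewrite lte_fin => fa; have [|V Vx HV] := H x (c - a).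
    by rewrite /= lte_fin; lra.
  exists V => // y /HV; rewrite /= !lte_fin; lra.
Qed.

Theorem corollary2 (R : realType) (X : topologicalType) (A : set X)
    (hX : hausdorff_space X) (hA : closed A)
    (hC : completely_normal_space X \/
          (@normal_space X /\ perfectly_normal_space A))
    (f g : A -> R)
    (f01 : forall x : A, 0 <= f x <= 1)
    (g01 : forall x : A, 0 <= g x <= 1)
    (f_lsc : lower_semicontinuous (EFin \o f))
    (g_usc : upper_semicontinuous (EFin \o g))
    (le_fg : forall x : A, f x <= g x) :
  exists f' g' : X -> R,
    (forall x : X, 0 <= f' x <= 1) /\
    (forall x : X, 0 <= g' x <= 1) /\
    (forall x : A, f' (val x) = f x) /\
    (forall x : A, g' (val x) = g x) /\
    lower_semicontinuous (EFin \o f') /\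
    upper_semicontinuous (EFin \o g') /\
    (forall x : X, f' x <= g' x).
Proof.
pose U (q : rat) := [set x : A | ratr q < f x].
pose V (q : rat) := [set x : A | g x < ratr q].
have oU q : open (U q) by exact: lower_semicontinuous_open.
have oV q : open (V q).
  have -> : V q = [set x | 1 - ratr q < 1 - g x].
    by apply/seteqP; split=> x /=; rewrite /V /=; lra.
  exact/lower_semicontinuous_open/lower_semicontinuous_subl.
have [|| |U' [V' [oU' oV' UU' VV' U'V']]] := @open_separated_family X
    (fun q => val @` U q) (fun q => val @` V q).
- move=> s q sq; apply: image_subset => x; apply: le_lt_trans.
  by rewrite ler_rat.
- by move=> s q sq; apply: image_subset => x /lt_le_trans; apply; rewrite ler_rat.
- move=> q; apply: open_separated_val => //; rewrite -subset0 => x [qf gq].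
  by have := lt_trans gq qf; rewrite ltNge le_fg.
(* The sets only shrink here, so the disjointness of [U'] and [V'] survives while the traces become
   exact. *)
have /choice[P HP] q := open_trace hA (oU q) (oU' q) (UU' q).
have /choice[Q HQ] q := open_trace hA (oV q) (oV' q) (VV' q).
(* [g'] is obtained from the lower semicontinuous function [1 - g], whose
   superlevel set at [q] is [V (1 - q)]. *)
pose Q1 q := Q (1 - q).
exists (level_sup R P), (fun x => 1 - level_sup R Q1 x).
split; first exact: level_sup01.
split; first by move=> x; have := level_sup01 R Q1 x; lra.
split.
  move=> x; apply: level_supE => // q; have [_ _ PU] := HP q.
  by rewrite -[P q _]/((val @^-1` P q) x) PU.
split.
  move=> x; suff -> : level_sup R Q1 (val x) = 1 - g x by lra.
  apply: level_supE => [|q]; first by have := g01 x; lra.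
  have [_ _ QV] := HQ (1 - q).
  rewrite -[Q1 q _]/((val @^-1` Q (1 - q)) x) QV /V /= rmorphB rmorph1.
  by split; lra.
split; first by apply: level_sup_lsc => q; case: (HP q).
split.
  apply/(lower_semicontinuous_subl 1).
  have -> : (fun x => 1 - (1 - level_sup R Q1 x)) = level_sup R Q1.
    by apply/funext => x; lra.
  by apply: level_sup_lsc => q; case: (HQ (1 - q)).
(* Bounding both suprema elementwise reduces the inequality to [t + s <= 1]; if either term is [0],
   the bound by [1] is enough. *)
move=> x; apply: ge_sup; first exact: level_set_neq0.
move=> t Pt; suff : level_sup R Q1 x <= 1 - t by lra.
apply: ge_sup; first exact: level_set_neq0.
move=> s Qs; have := level_set_ubound1 Pt; have := level_set_ubound1 Qs.
case: Pt Qs => [->|[p [_ Pp ->]]] [->|[q [_ Qq ->]]]; try lra.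
move=> _ _; suff : ratr q <= ratr (1 - p) :> R by rewrite rmorphB rmorph1.
(* Otherwise [1 - q < p], and [x] would lie in both [U' p] and [V' (1 - q)]. *)
rewrite ler_rat leNgt; apply/negP => pq.
have [_ PU' _] := HP p; have [_ QV' _] := HQ (1 - q).
suff : set0 x by [].
rewrite -(U'V' (1 - q) p); first by split; [exact: PU'|exact: QV'].
by lra.
Qed.
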